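(* Let $\Omega\subset\mathbb{R}^2$ be a bounded strictly convex domain, let $a>0$ and let $H<1$ be a real constant. Let $u>0$ be a solution of $$\mathrm{div}\left(\frac{Du}{\sqrt{1+|Du|^2}}\right)=-\frac{2}{u}\left(\frac{1}{\sqrt{1+|Du|^2}}-H\right)\ \text{ in }\Omega,\qquad u=a\ \text{ on }\partial\Omega.$$ Denote $u_M=\sup_\Omega u$ and $$C=\frac{1}{1-H}\,\frac{u_M^2}{a^2}.$$ If either $0\leq H<1$, or $H<0$ and $$u_M<\sqrt{\frac{H-1}{H}}\,a,$$ then $$|Du|\leq\frac{\sqrt{C^2-(1+HC)^2}}{1+HC}\quad\text{in }\Omega.$$
   Context: Here $D$ and $\mathrm{div}$ are the Euclidean gradient and divergence in $\mathbb{R}^2$, and $|\cdot|$ is the Euclidean norm. A solution of the Dirichlet problem is a smooth function $u>0$ in $\Omega$ satisfying the equation in $\Omega$ and the boundary condition on $\partial\Omega$. *)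

(* Defs.v *)
From HB Require Import structures.
From mathcomp Require Import all_boot all_order all_algebra.
From mathcomp Require Import all_classical all_reals all_analysis.
Import Order.TTheory GRing.Theory Num.Theory.
Import numFieldNormedType.Exports.

Set Implicit Arguments.
Unset Strict Implicit.
Unset Printing Implicit Defensive.

Local Open Scope classical_set_scope.
Local Open Scope ring_scope.

(* The library norm on 'rV[R]_n is the sup norm; it is used only through the
   topology and the boundedness predicate, which do not depend on the choice of
   norm.  The length of a vector is the following Euclidean norm. *)
Definition enorm (R : realType) (n : nat) (v : 'rV[R]_n) : R :=
  Num.sqrt (\sum_(i < n) v 0 i ^+ 2).

Definition partial (R : realType) (n : nat) (i : 'I_n) (f : 'rV[R]_n -> R) :
    'rV[R]_n -> R :=
  fun x => 'D_(delta_mx 0 i) f x.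

Definition gradient (R : realType) (n : nat) (f : 'rV[R]_n -> R)
    (x : 'rV[R]_n) : 'rV[R]_n :=
  \row_(i < n) partial i f x.

Definition divergence (R : realType) (n : nat) (F : 'rV[R]_n -> 'rV[R]_n)
    (x : 'rV[R]_n) : R :=
  \sum_(i < n) partial i (fun y => F y 0 i) x.

(* C^infinity on an open set A: the partial derivatives of f of every order,
   along every sequence s of coordinate indices, are Frechet differentiable at
   every point of A. *)
Definition smooth_on (R : realType) (n : nat) (A : set 'rV[R]_n)
    (f : 'rV[R]_n -> R) : Prop :=
  forall (s : seq 'I_n) (x : 'rV[R]_n),
    A x -> differentiable (foldr (@partial R n) f s) x.

Definition boundary (T : topologicalType) (A : set T) : set T :=
  closure A `\` interior A.

Definition domain (T : topologicalType) (A : set T) : Prop :=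
  [/\ A !=set0, open A & connected A].

(* The open segment joining two distinct points of the closure lies in the
   interior; in particular the boundary contains no segment.  No regularity of
   the boundary is required. *)
Definition strictly_convex (R : realType) (n : nat) (A : set 'rV[R]_n) : Prop :=
  forall x y : 'rV[R]_n, closure A x -> closure A y -> x != y ->
  forall t : R, 0 < t < 1 -> interior A ((1 - t) *: x + t *: y).

(* Smooth positive solutions of the Dirichlet problem.  The boundary condition
   is understood for u continuous up to the boundary; the values of u outside
   the closure of A are irrelevant. *)
Definition dirichlet_solution (R : realType) (A : set 'rV[R]_2) (a H : R)
    (u : 'rV[R]_2 -> R) : Prop :=
  [/\ smooth_on A u,
      {within closure A, continuous u},
      forall x, A x -> 0 < u x,
      forall x, A x ->
        divergence (fun y => (Num.sqrt (1 + enorm (gradient u y) ^+ 2))^-1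
                               *: gradient u y) x
        = - (2 / u x) * ((Num.sqrt (1 + enorm (gradient u x) ^+ 2))^-1 - H) &
      forall x, boundary A x -> u x = a].

(* Main.v *)
Require Import Defs.
From HB Require Import structures.
From mathcomp Require Import all_boot all_order all_algebra.
From mathcomp Require Import all_classical all_reals all_analysis.
From mathcomp Require Import ring lra.
Import Order.TTheory GRing.Theory Num.Theory.
Import numFieldNormedType.Exports.

Local Open Scope classical_set_scope.
Local Open Scope ring_scope.

Set Implicit Arguments.
Unset Strict Implicit.
Unset Printing Implicit Defensive.

(** Write [w = 1 / sqrt (1 + |Du|^2)] for the cosine of the angle between the
    normal of the graph and the vertical, and [nu0 = H + (1 - H) a^2 / u_M^2].
    Since [1 / C = (1 - H) a^2 / u_M^2], the claimed bound is [nu0 <= w], and the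
    condition imposed when [H < 0] says that [nu0 > 0].

    The number [nu0] comes from the solutions of the equation that depend on
    one variable: along such a solution [(w - H) / u^2] is constant, so the one
    whose maximum is [u_M] meets the height [a] at the angle with cosine [nu0].
    The proof compares [u] with this profile at the boundary and then carries
    the estimate inside.  Every comparison is a first and second derivative
    test at an extremum.  These tests suffice because
    [w^3 mean_hess = -(2 / u) (w - H)], where [mean_hess] is a sum of three second
    derivatives of [u] along lines, in directions that depend only on [Du]
    ([divergence_mean_hess], [jet2_max]).

    - An interior minimum of [u] would have [w = 1] and [mean_hess >= 0], which
      the equation excludes; hence [u >= a] ([solution_ge]).
    - For small [d > 0] the profile with [nu0 - d] in place of [nu0] is a strict
      supersolution ([strict_barrier_exists]).  Over a half-plane containing
      the domain it therefore stays above [u] ([halfplane_barrier]).  A point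
      outside the closure is separated from it by such a half-plane, and by
      strict convexity every boundary point is a limit of exterior points.
      This gives [u y <= a + K |y - x|] for [x] on the boundary, [K] being the
      slope with cosine [nu0 - d] ([boundary_growth]).
    - The function [u y - u x - K |y - x|] of the pair [(x, y)] attains its
      maximum over the closure.  Were it positive, both points would be
      interior by the previous steps.  Moving them together shows that [Du] is
      the same at [x] and [y] and that [mean_hess] is not larger at [y]; moving
      [y] alone shows [|Du| <= K], so [w > H].  The equation then gives
      [u y <= u x], a contradiction ([solution_lipschitz]).

    So [u] is [K]-Lipschitz, whence [w >= nu0 - d] inside for every small [d]
    ([tilt_lower_bound]). *)

(** * Second-order tests along a line *)

(** [a] and [b] are the first and second derivatives of [f] at [0]; naming the
    derivative [g] near [0] avoids iterating a total derivative operator. *)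
Definition jet2 (R : realType) (f : R -> R) (a b : R) : Prop :=
  exists g : R -> R, [/\ \forall t \near (0 : R), is_derive (t : R) 1 f (g t),
    g 0 = a & is_derive (0 : R) 1 g b].

Lemma is_derive_gt0_near (R : realType) (g : R -> R) (c : R) :
  is_derive (0 : R) 1 g c -> 0 < c ->
  exists2 e : R, 0 < e & forall t, 0 < t -> t < e -> g 0 < g t.
Proof.
case=> dg gc c0.
have : h^-1 *: (g (h *: 1 + 0) - g 0) @[h --> 0^'] --> c.
  by rewrite -gc; exact: dg.
move/cvgrPdist_lt => /(_ _ c0)[e /= e0 He].
exists e => // t t0 te.
have := He t; rewrite /= sub0r normrN gtr0_norm // => /(_ te (lt0r_neq0 t0)).
rewrite addr0 /= [t%:A]mulr1 => /ltr_normlP[_ K].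
have {}K : c - t^-1 * (g t - g 0) < c := K.
have : 0 < t^-1 * (g t - g 0) by lra.
by rewrite pmulr_rgt0 ?invr_gt0 // subr_gt0.
Qed.

(** If [b] were positive, the derivative, which vanishes at [0], would be
    positive just to the right of [0], and [f] would increase there. *)
Lemma jet2_max (R : realType) (f : R -> R) (a b : R) : jet2 f a b ->
  (\forall t \near (0 : R), f t <= f 0) -> a = 0 /\ b <= 0.
Proof.
move=> [g [fg ga gb]] fmax.
have [e /= e0 He] : \forall t \near (0 : R), is_derive (t : R) 1 f (g t) /\ f t <= f 0.
  by apply: filterS2 fg fmax.
have {}He (t : R) : t \in `]- e, e[ -> is_derive t 1 f (g t) /\ f t <= f 0.
  move=> te; apply: He; rewrite /= sub0r normrN.
  by rewrite ltr_norml !(itvP te).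
have z0 : (0 : R) \in `]- e, e[ by rewrite in_itv /= e0 oppr_lt0 e0.
have D0 : is_derive (0 : R) 1 f 0.
  apply: (@derive1_at_max _ f (- e) e 0) => //.
  - by rewrite ltW // (lt_trans _ e0) // oppr_lt0.
  - by move=> t /He[[]].
  - by move=> t /He[].
have g0 : g 0 = 0.
  have [[_ <-] _] := He _ z0; by case: D0.
split; first by rewrite -ga.
rewrite leNgt; apply/negP => b0.
have [e' e'0 He'] := is_derive_gt0_near gb b0.
pose t := Num.min e e' / 2.
have t0 : 0 < t by rewrite divr_gt0 // lt_min e0 e'0.
have [te te'] : t < e /\ t < e'.
  have: t < Num.min e e' by rewrite /t ltr_pdivrMr // ltr_pMr ?ltr1n // lt_min e0 e'0.
  by rewrite lt_min => /andP.
have inI s : 0 <= s <= t -> s \in `]- e, e[.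
  move=> /andP[s0 st]; rewrite in_itv /=; apply/andP; split; lra.
have df s : s \in `]0, t[ -> is_derive s 1 f (g s).
  by move=> st; apply: (He s (inI s _)).1; rewrite !ltW ?(itvP st).
have cf : {within `[0, t], continuous f}.
  by apply: derivable_within_continuous => s st; case: (He s (inI s _)).1.
have [s st] := MVT t0 df cf.
have := (He t (inI t _)).2; rewrite lexx (ltW t0) => /(_ isT) H1.
move=> H2; have : 0 < g s * (t - 0).
  rewrite subr0 mulr_gt0 // -g0; apply: He'; rewrite ?(itvP st) //.
  by rewrite (lt_trans _ te') // (itvP st).
rewrite -H2; lra.
Qed.

Lemma jet2B (R : realType) (f f' : R -> R) (a a' b b' : R) :
  jet2 f a b -> jet2 f' a' b' -> jet2 (fun t => f t - f' t) (a - a') (b - b').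
Proof.
move=> [g [fg <- gb]] [g' [fg' <- gb']]; exists (fun t => g t - g' t); split=> //.
- by apply: filterS2 fg fg' => t ft f't; exact: is_deriveB.
- exact: is_deriveB.
Qed.

Lemma jet2_affine (R : realType) (c k : R) : jet2 (fun t => c + t * k) k 0.
Proof.
have -> : (fun t => c + t * k) = cst c + k *: id.
  by apply/funext => t; rewrite /= mulrC.
exists (cst k); split=> //; last exact: is_derive_cst.
near=> t; have := is_deriveD (is_derive_cst c t 1) (is_deriveZ k (is_derive_id t 1)).
by rewrite add0r /GRing.scale/= mulr1.
Unshelve. all: by end_near. Qed.

(** The chain rule to second order: [q] is the derivative of [G] and [c] that of
    [q]. *)
Lemma jet2_comp (R : realType) (G q f : R -> R) (a b c : R) :
  jet2 f a b ->
  (\forall z \near f 0, is_derive (z : R) 1 G (q z)) ->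
  is_derive (f 0) 1 q c ->
  jet2 (G \o f) (q (f 0) * a) (c * a ^+ 2 + q (f 0) * b).
Proof.
move=> [g [fg ga gb]] Gq qc.
have f0 : is_derive (0 : R) 1 f (g 0) by exact: nbhs_singleton fg.
have cf : {for 0, continuous f}.
  by apply: differentiable_continuous; apply/derivable1_diffP; case: f0.
exists (fun t => q (f t) * g t); split.
- have Gqf : \forall t \near (0 : R), is_derive (f t) 1 G (q (f t)) by exact: cf Gq.
  by apply: filterS2 fg Gqf => t ft Gt; exact: is_derive1_comp.
- by rewrite ga.
- have qf : is_derive (0 : R) 1 (q \o f) (c * g 0) by exact: is_derive1_comp.
  have qfg := @is_deriveM _ _ (q \o f) g _ _ _ _ qf gb.
  apply: (@is_derive_eq _ _ _ ((q \o f) * g) _ _ _ _ qfg).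
  rewrite /GRing.scale/= ga; ring.
Qed.

Definition dot (R : realType) (n : nat) (v w : 'rV[R]_n) : R :=
  \sum_(i < n) v 0 i * w 0 i.

Lemma diff_gradient (R : realType) (n : nat) (f : 'rV[R]_n -> R)
    (y h : 'rV[R]_n) : differentiable f y -> 'd f y h = dot h (gradient f y).
Proof.
move=> df; rewrite {1}(row_sum_delta h) linear_sum.
by apply: eq_bigr => i _; rewrite linearZ [in RHS]mxE /partial deriveE.
Qed.

Lemma is_diff_line (R : realType) (n : nat) (x h : 'rV[R]_n) (t : R) :
  is_diff t (fun s : R => x + s *: h) (fun s => s *: h).
Proof. by apply: is_diff_eq; rewrite add0r. Qed.

Lemma near_line (R : realType) (n : nat) (A : set 'rV[R]_n) (x h : 'rV[R]_n) :
  open A -> A x -> \forall t \near (0 : R), A (x + t *: h).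
Proof.
move=> oA Ax.
have cl : {for 0, continuous (fun s : R => x + s *: h)}.
  by apply: differentiable_continuous; case: (is_diff_line x h 0).
by apply: cl; rewrite scale0r addr0; apply: open_nbhs_nbhs.
Qed.

Lemma is_derive_line (R : realType) (n : nat) (f : 'rV[R]_n -> R)
    (x h : 'rV[R]_n) (t : R) : differentiable f (x + t *: h) ->
  is_derive t 1 (fun s => f (x + s *: h)) (dot h (gradient f (x + t *: h))).
Proof.
move=> df.
have dl := is_diff_line x h t.
have dc : is_diff t (f \o (fun s : R => x + s *: h))
    ('d f (x + t *: h) \o (fun s => s *: h)).
  by apply: is_diff_comp; apply: DiffDef.
split; first by apply/derivable1_diffP; exact: ex_diff.
rewrite deriveE; last exact: ex_diff.
by rewrite diff_val /= scale1r diff_gradient.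
Qed.

(** The second derivative of [f] at [x] along [h]: each mixed partial derivative
    enters in both orders, as it does in the expanded divergence. *)
Definition hessq (R : realType) (n : nat) (f : 'rV[R]_n -> R)
    (x h : 'rV[R]_n) : R :=
  dot h (\row_(i < n) dot h (gradient (partial i f) x)).

Lemma jet2_line (R : realType) (n : nat) (A : set 'rV[R]_n)
    (f : 'rV[R]_n -> R) (x h : 'rV[R]_n) : open A -> smooth_on A f -> A x ->
  jet2 (fun t => f (x + t *: h)) (dot h (gradient f x)) (hessq f x h).
Proof.
move=> oA sf Ax.
exists (fun t => dot h (gradient f (x + t *: h))); split.
- have := near_line h oA Ax.
  apply: filterS => t At; apply: is_derive_line; exact: (sf [::]).
- by rewrite scale0r addr0.
- have -> : hessq f x h = \sum_(i < n) h 0 i * dot h (gradient (partial i f) x).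
    by apply: eq_bigr => i _; rewrite [in LHS]mxE.
  have -> : (fun t => dot h (gradient f (x + t *: h))) =
     \sum_(i < n) (fun t : R => h 0 i *: partial i f (x + t *: h)).
    by apply/funext => t; rewrite fct_sumE; apply: eq_bigr => i _; rewrite mxE.
  apply: is_derive_sum => i; apply: is_deriveZ.
  apply: is_derive_eq.
    by apply: is_derive_line; rewrite scale0r addr0; exact: (sf [:: i]).
  by rewrite scale0r addr0.
Qed.

(** * Euclidean length *)

Lemma enorm_ge0 (R : realType) (n : nat) (v : 'rV[R]_n) : 0 <= enorm v.
Proof. exact: sqrtr_ge0. Qed.

Lemma enorm_sqr (R : realType) (n : nat) (v : 'rV[R]_n) :
  enorm v ^+ 2 = dot v v.
Proof.
rewrite sqr_sqrtr; last by apply: sumr_ge0 => i _; exact: sqr_ge0.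
by apply: eq_bigr => i _; rewrite expr2.
Qed.

Lemma dotC (R : realType) (n : nat) (v w : 'rV[R]_n) : dot v w = dot w v.
Proof. by apply: eq_bigr => i _; rewrite mulrC. Qed.

Lemma dotDl (R : realType) (n : nat) (v v' w : 'rV[R]_n) :
  dot (v + v') w = dot v w + dot v' w.
Proof. by rewrite -big_split; apply: eq_bigr => i _; rewrite mxE mulrDl. Qed.

Lemma dotZl (R : realType) (n : nat) (k : R) (v w : 'rV[R]_n) :
  dot (k *: v) w = k * dot v w.
Proof. by rewrite /dot mulr_sumr; apply: eq_bigr => i _; rewrite mxE mulrA. Qed.

Lemma dotBl (R : realType) (n : nat) (v v' w : 'rV[R]_n) :
  dot (v - v') w = dot v w - dot v' w.
Proof. by rewrite -scaleN1r dotDl dotZl mulN1r. Qed.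

Lemma dotDr (R : realType) (n : nat) (v w w' : 'rV[R]_n) :
  dot v (w + w') = dot v w + dot v w'.
Proof. by rewrite ![dot v _]dotC dotDl. Qed.

Lemma dotZr (R : realType) (n : nat) (k : R) (v w : 'rV[R]_n) :
  dot v (k *: w) = k * dot v w.
Proof. by rewrite ![dot v _]dotC dotZl. Qed.

Lemma dotBr (R : realType) (n : nat) (v w w' : 'rV[R]_n) :
  dot v (w - w') = dot v w - dot v w'.
Proof. by rewrite ![dot v _]dotC dotBl. Qed.

Lemma dot_delta (R : realType) (n : nat) (i : 'I_n) (w : 'rV[R]_n) :
  dot (delta_mx 0 i) w = w 0 i.
Proof.
rewrite /dot (bigD1 i) //= mxE !eqxx mul1r big1 ?addr0 // => j ji.
by rewrite mxE eqxx (negbTE ji) mul0r.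
Qed.

Lemma dot0l (R : realType) (n : nat) (w : 'rV[R]_n) : dot 0 w = 0.
Proof. by rewrite -(scale0r 0) dotZl mul0r. Qed.

Lemma enorm_eq0 (R : realType) (n : nat) (v : 'rV[R]_n) : enorm v = 0 -> v = 0.
Proof.
move=> v0; have : enorm v ^+ 2 = 0 by rewrite v0 expr0n.
rewrite enorm_sqr => /psumr_eq0P dv; apply/rowP => i; rewrite mxE.
apply/eqP; rewrite -sqrf_eq0 expr2; apply/eqP; apply: dv => // j _.
by rewrite -expr2 sqr_ge0.
Qed.

(** Expand the square of the length of [enorm w *: v - enorm v *: w]. *)
Lemma dot_enorm (R : realType) (n : nat) (v w : 'rV[R]_n) :
  dot v w <= enorm v * enorm w.
Proof.
have [v0|v0] := eqVneq (enorm v) 0.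
  by rewrite v0 mul0r (enorm_eq0 v0) dot0l.
have [w0|w0] := eqVneq (enorm w) 0.
  by rewrite w0 mulr0 (enorm_eq0 w0) dotC dot0l.
have a0 : 0 < enorm v by rewrite lt_def v0 enorm_ge0.
have b0 : 0 < enorm w by rewrite lt_def w0 enorm_ge0.
have : 0 <= enorm (enorm w *: v - enorm v *: w) ^+ 2 by exact: sqr_ge0.
rewrite enorm_sqr !(dotBl, dotBr, dotZl, dotZr) -!enorm_sqr [dot w v]dotC.
set a := enorm v; set b := enorm w; set d := dot v w => H.
have {}H : 0 <= (2 * (a * b)) * (a * b - d) by nra.
have ab : 0 < 2 * (a * b) by rewrite !mulr_gt0.
by move: H; rewrite pmulr_rge0 // subr_ge0.
Qed.

Lemma enormZ (R : realType) (n : nat) (k : R) (v : 'rV[R]_n) :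
  0 <= k -> enorm (k *: v) = k * enorm v.
Proof.
move=> k0; apply/eqP; rewrite -(@eqrXn2 _ 2) ?enorm_ge0 ?mulr_ge0 ?enorm_ge0 //.
by rewrite exprMn !enorm_sqr dotZl dotZr mulrA expr2.
Qed.

Lemma enormD (R : realType) (n : nat) (v w : 'rV[R]_n) :
  enorm (v + w) <= enorm v + enorm w.
Proof.
rewrite -(@ler_pXn2r _ 2) ?nnegrE ?addr_ge0 ?enorm_ge0 //.
rewrite enorm_sqr !(dotDl, dotDr) sqrrD !enorm_sqr [dot w v]dotC.
have := dot_enorm v w; lra.
Qed.

Lemma enorm_continuous (R : realType) (n : nat) :
  continuous (@enorm R n).
Proof.
move=> x; apply: continuous_comp; last exact: sqrt_continuous.
apply: differentiable_continuous.
have -> : (fun v : 'rV[R]_n => \sum_(i < n) v 0 i ^+ 2) =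
    \sum_(i < n) (fun v : 'rV[R]_n => v 0 i) ^+ 2.
  by apply/funext => v; rewrite fct_sumE.
by apply: differentiable_sum => i; apply: differentiableX; exact: differentiable_coord.
Qed.

(** * The divergence as a sum of second derivatives along lines *)

Lemma is_derive_of_line (R : realType) (n : nat) (f : 'rV[R]_n -> R)
    (x v : 'rV[R]_n) (d : R) :
  is_derive (0 : R) 1 (fun t => f (x + t *: v)) d -> is_derive x v f d.
Proof.
have -> : (fun t => f (x + t *: v)) = (fun t => f (t *: v + x)).
  by apply/funext => t; rewrite addrC.
case=> df <-; split; first by apply/derivable1P.
rewrite /derive.
set F := (X in lim (X @ _)); set G := (X in _ = lim (X @ _)).
suff -> : F = G by [].
apply/funext => h; rewrite /F /G /=.
by rewrite scale0r add0r addr0 [h%:A]mulr1.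
Qed.

Lemma is_derive_unit_normal (R : realType) (n : nat) (p : 'I_n -> R -> R)
    (d : 'I_n -> R) (i : 'I_n) :
  (forall j, is_derive (0 : R) 1 (p j) (d j)) ->
  let w := (Num.sqrt (1 + \sum_(j < n) p j 0 ^+ 2))^-1 in
  is_derive (0 : R) 1
    (fun t => (Num.sqrt (1 + \sum_(j < n) p j t ^+ 2))^-1 * p i t)
    (w * d i - w ^+ 3 * (p i 0 * \sum_(j < n) p j 0 * d j)).
Proof.
move=> dp w.
pose S t := 1 + \sum_(j < n) p j t ^+ 2.
have S0 : 0 < S 0 by rewrite ltr_pwDl // sumr_ge0 // => j _; exact: sqr_ge0.
have dS : is_derive (0 : R) 1 S (2 * \sum_(j < n) p j 0 * d j).
  have -> : S = cst 1 + \sum_(j < n) (p j * p j).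
    by apply/funext => t; rewrite /S fctE /= fct_sumE; congr (_ + _).
  have := is_deriveD (is_derive_cst (1 : R) (0 : R) 1)
    (is_derive_sum (fun j => is_deriveM (dp j) (dp j))).
  move/is_derive_eq; apply; rewrite add0r mulr_sumr; apply: eq_bigr => j _.
  rewrite /GRing.scale/=; ring.
have dq : is_derive (0 : R) 1 (Num.sqrt \o S) _ :=
  is_derive1_comp (is_derive1_sqrt S0) dS.
have q0 : Num.sqrt (S 0) != 0 by rewrite sqrtr_eq0 -ltNge.
have dV : is_derive (0 : R) 1 (fun t => (Num.sqrt (S t))^-1)
  (- w ^+ 3 * (\sum_(j < n) p j 0 * d j)).
  case: dq => dq eq; split; first exact: derivableV.
  rewrite deriveV // eq /GRing.scale/=. rewrite /w; field.
  exact: q0.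
have := is_deriveM dV (dp i) => /is_derive_eq; apply.
rewrite /GRing.scale/= -/w; ring.
Qed.

(** The cosine of the angle with the vertical of the normal to a graph of slope
    [s]. *)
Definition tilt_of (R : realType) (s : R) : R := (Num.sqrt (1 + s ^+ 2))^-1.

Lemma tilt_of_gt0 (R : realType) (s : R) : 0 < tilt_of s.
Proof. by rewrite invr_gt0 sqrtr_gt0 ltr_pwDl // sqr_ge0. Qed.

Lemma tilt_of_sqr (R : realType) (s : R) : tilt_of s ^+ 2 = (1 + s ^+ 2)^-1.
Proof. by rewrite exprVn sqr_sqrtr // addr_ge0 // sqr_ge0. Qed.

Lemma tilt_of_le (R : realType) (s r : R) : 0 <= s -> s <= r -> tilt_of r <= tilt_of s.
Proof.
move=> s0 sr; rewrite lef_pV2 ?posrE ?sqrtr_gt0 ?ltr_pwDl ?sqr_ge0 //.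
by rewrite ler_wsqrtr // lerD2l ler_pXn2r // nnegrE // (le_trans s0).
Qed.

Definition tilt (R : realType) (n : nat) (u : 'rV[R]_n -> R) (x : 'rV[R]_n) : R :=
  tilt_of (enorm (gradient u x)).

Lemma divergence_tilt (R : realType) (n : nat) (A : set 'rV[R]_n)
    (u : 'rV[R]_n -> R) (x : 'rV[R]_n) : open A -> smooth_on A u -> A x ->
  divergence (fun y => tilt u y *: gradient u y) x =
  \sum_(i < n) (tilt u x * partial i (partial i u) x - tilt u x ^+ 3 *
    (partial i u x * \sum_(j < n) partial j u x * partial i (partial j u) x)).
Proof.
move=> oA su Ax; apply: eq_bigr => i _; rewrite {1}/partial.
suff [_ ->] : is_derive x (delta_mx 0 i)
  (fun y => (tilt u y *: gradient u y) 0 i)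
  (tilt u x * partial i (partial i u) x - tilt u x ^+ 3 *
    (partial i u x * \sum_(j < n) partial j u x * partial i (partial j u) x)) by [].
apply: is_derive_of_line.
have dp j : is_derive (0 : R) 1 (fun t => partial j u (x + t *: delta_mx 0 i))
    (partial i (partial j u) x).
  apply: is_derive_eq.
    by apply: is_derive_line; rewrite scale0r addr0; exact: (su [:: j]).
  by rewrite dot_delta mxE scale0r addr0.
have := is_derive_unit_normal i dp.
have tiltE y : (Num.sqrt (1 + \sum_(j < n) partial j u y ^+ 2))^-1 = tilt u y.
  rewrite /tilt /tilt_of enorm_sqr; congr (Num.sqrt (1 + _))^-1.
  by apply: eq_bigr => j _; rewrite mxE expr2.
rewrite /= scale0r addr0 tiltE.
suff -> : (fun t : R => (tilt u (x + t *: delta_mx 0 i) *: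
    gradient u (x + t *: delta_mx 0 i)) 0 i) = (fun t =>
      (Num.sqrt (1 + \sum_(j < n) partial j u (x + t *: delta_mx 0 i) ^+ 2))^-1 *
      partial i u (x + t *: delta_mx 0 i)) by [].
by apply/funext => t; rewrite tiltE !mxE.
Qed.

Lemma sum_ord2 (R : realType) (F : 'I_2 -> R) :
  \sum_(i < 2) F i = F ord0 + F ord_max.
Proof.
rewrite big_ord_recl big_ord1; congr (_ + F _); exact/val_inj.
Qed.

(** The quarter turn; [rot (gradient u x)] is the direction in which [u] is
    stationary at [x]. *)
Definition rot (R : realType) (v : 'rV[R]_2) : 'rV[R]_2 :=
  \row_(i < 2) (if i == ord0 then v 0 ord_max else - v 0 ord0).

(** In the plane, [(1 + |p|^2) I - p p^T = I + p' p'^T] with [p'] the quarter turn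
    of [p].  The left side, for [p = Du], is the matrix of the second-order part
    of the equation, so that part is a sum of squares of directions. *)
Definition mean_hess (R : realType) (u : 'rV[R]_2 -> R) (x : 'rV[R]_2) : R :=
  hessq u x (delta_mx 0 ord0) + hessq u x (delta_mx 0 ord_max)
  + hessq u x (rot (gradient u x)).

Lemma hessq_delta (R : realType) (n : nat) (f : 'rV[R]_n -> R) (x : 'rV[R]_n)
    (i : 'I_n) : hessq f x (delta_mx 0 i) = partial i (partial i f) x.
Proof.
by rewrite /hessq dot_delta mxE dot_delta mxE.
Qed.

Lemma hessqE (R : realType) (n : nat) (f : 'rV[R]_n -> R) (x h : 'rV[R]_n) :
  hessq f x h =
  \sum_(i < n) h 0 i * \sum_(j < n) h 0 j * partial j (partial i f) x.
Proof.
apply: eq_bigr => i _; rewrite [in LHS]mxE; congr (_ * _).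
by apply: eq_bigr => j _; rewrite [in LHS]mxE.
Qed.

Lemma dot_rot (R : realType) (v : 'rV[R]_2) : dot (rot v) v = 0.
Proof.
by rewrite /dot sum_ord2 !mxE /=; ring.
Qed.

Lemma rot0 (R : realType) (v : 'rV[R]_2) : rot v 0 ord0 = v 0 ord_max.
Proof. by rewrite mxE. Qed.

Lemma rot1 (R : realType) (v : 'rV[R]_2) : rot v 0 ord_max = - v 0 ord0.
Proof. by rewrite mxE. Qed.

Lemma trace_rot (R : realType) (w : R) (v : 'rV[R]_2) (U : 'I_2 -> 'I_2 -> R) :
  w * (w ^+ 2 * (1 + enorm v ^+ 2)) = w ->
  \sum_(i < 2) (w * U i i - w ^+ 3 * (v 0 i * \sum_(j < 2) v 0 j * U j i)) =
  w ^+ 3 * (U ord0 ord0 + U ord_max ord_max +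
    \sum_(i < 2) rot v 0 i * \sum_(j < 2) rot v 0 j * U i j).
Proof.
move=> t2; rewrite enorm_sqr /dot !sum_ord2 in t2.
rewrite !sum_ord2 !rot0 !rot1 -{1 3}t2; ring.
Qed.

Lemma divergence_mean_hess (R : realType) (A : set 'rV[R]_2)
    (u : 'rV[R]_2 -> R) (x : 'rV[R]_2) : open A -> smooth_on A u -> A x ->
  divergence (fun y => tilt u y *: gradient u y) x = tilt u x ^+ 3 * mean_hess u x.
Proof.
move=> oA su Ax; rewrite (divergence_tilt oA su Ax) /mean_hess !hessq_delta hessqE.
have t2 : tilt u x * (tilt u x ^+ 2 * (1 + enorm (gradient u x) ^+ 2)) = tilt u x.
  by rewrite tilt_of_sqr mulVf ?mulr1 // gt_eqF // ltr_pwDl // sqr_ge0.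
rewrite -(trace_rot (fun i j => partial j (partial i u) x) t2).
have pE i : gradient u x 0 i = partial i u x by rewrite [LHS]mxE.
apply: eq_bigr => i _; rewrite pE; congr (_ - _ * (_ * _)).
by apply: eq_bigr => j _; rewrite pE.
Qed.

(** * Supporting half-planes *)

Lemma compact_closure_bounded (R : realType) (n : nat) (A : set 'rV[R]_n) :
  bounded_set A -> compact (closure A).
Proof.
move=> bA; apply: bounded_closed_compact; last exact: closed_closure.
case: bA => M [Mr HM]; exists M; split=> // N MN x.
have cN : closed [set y : 'rV[R]_n | `|y| <= N].
  have := @closed_comp _ _ (fun y : 'rV[R]_n => `|y|) [set r : R | r <= N].
  by apply; [move=> y _; exact: norm_continuous | exact: closed_le].
suff : closure A `<=` [set y : 'rV[R]_n | `|y| <= N] by exact.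
rewrite ((closure_id _).1 cN); apply: closure_subset => y; exact: HM.
Qed.

Lemma closure_open_boundary (T : topologicalType) (A : set T) (x : T) :
  open A -> closure A x -> A x \/ boundary A x.
Proof.
move=> oA cx; have [Ax|nAx] := pselect (A x); [by left|right; split=> //].
by move=> /interior_subset.
Qed.

Lemma strictly_convex_closure (R : realType) (n : nat) (A : set 'rV[R]_n)
    (x y : 'rV[R]_n) (t : R) : strictly_convex A -> closure A x -> closure A y ->
  0 < t < 1 -> closure A ((1 - t) *: x + t *: y).
Proof.
move=> sA cx cy t01; have [->|xy] := eqVneq x y.
  by rewrite -scalerDl subrK scale1r.
apply: subset_closure; apply: interior_subset; exact: sA.
Qed.

(** The nearest point [p] of the closure to [z] gives [e], the direction from
    [z] to [p], and [k = dot e p]: moving from [p] towards another point of the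
    closure cannot decrease the distance to [z]. *)
Lemma separating_unit_vector (R : realType) (n : nat) (A : set 'rV[R]_n)
    (z : 'rV[R]_n) : A !=set0 -> bounded_set A -> strictly_convex A ->
  ~ closure A z ->
  exists e k, [/\ dot e e = 1, forall y, closure A y -> k <= dot e y & dot e z <= k].
Proof.
move=> A0 bA sA nz.
have cA0 : closure A !=set0 by case: A0 => x Ax; exists x; exact: subset_closure.
have dc : continuous (fun x : 'rV[R]_n => enorm (x - z)).
  move=> x; apply: (@continuous_comp _ _ _ (fun x : 'rV[R]_n => x - z) (@enorm R n)).
    apply: continuousB => y; [exact: id | exact: cst_continuous].
  exact: enorm_continuous.
have [p] := EVT_min_rV cA0 (compact_closure_bounded bA) (continuous_subspaceT dc).
rewrite inE => cp pmin.
pose r := enorm (p - z).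
have r0 : 0 < r.
  rewrite lt_def enorm_ge0 andbT; apply/eqP => /enorm_eq0/eqP.
  by rewrite subr_eq0 => /eqP pz; rewrite -pz in nz.
exists (r^-1 *: (p - z)), (dot (r^-1 *: (p - z)) p); split.
- rewrite dotZl dotZr -enorm_sqr -/r; field.
  exact: lt0r_neq0.
- move=> y cy; rewrite -subr_ge0 -dotBr dotZl mulr_ge0 ?invr_ge0 ?(ltW r0) //.
  set d := dot _ _; rewrite leNgt; apply/negP => d0.
  pose m := dot (y - p) (y - p).
  have m0 : 0 <= m by rewrite /m -enorm_sqr sqr_ge0.
  have s0 : 0 < m - 2 * d by lra.
  (* [t = - d / (m - 2 d)] makes [2 d + t m] negative while keeping [t < 1]. *)
  pose t := - d / (m - 2 * d).
  have ts : t * (m - 2 * d) = - d by rewrite /t divfK // lt0r_neq0.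
  have t0 : 0 < t by rewrite divr_gt0 // oppr_gt0.
  have t1 : t < 1 by rewrite /t ltr_pdivrMr //; lra.
  have : enorm (p - z) <= enorm ((1 - t) *: p + t *: y - z).
    apply: pmin; rewrite inE; apply: strictly_convex_closure => //.
    by rewrite t0.
  rewrite -(@ler_pXn2r _ 2) ?nnegrE ?enorm_ge0 // !enorm_sqr.
  have -> : (1 - t) *: p + t *: y - z = (p - z) + t *: (y - p).
    by apply/rowP => i; rewrite !mxE; ring.
  rewrite !(dotDl (p - z)) !(dotDr _ (p - z)) !dotZl !dotZr.
  rewrite [dot (y - p) (p - z)]dotC -/d -/m.
  nra.
- rewrite -subr_ge0 -dotBr dotZl -enorm_sqr mulr_ge0 ?invr_ge0 ?(ltW r0) ?sqr_ge0 //.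
Qed.

(** Otherwise [x] would be the midpoint of two points of the closure, hence an
    interior point.  Thus points outside the closure accumulate at [x], which
    is what lets estimates on exterior points pass to the boundary. *)
Lemma boundary_not_near_closure (R : realType) (n : nat) (A : set 'rV[R]_n.+1)
    (x : 'rV[R]_n.+1) : strictly_convex A -> boundary A x -> ~ nbhs x (closure A).
Proof.
move=> sA [cx nx] /nbhs_interior/nbhs_singleton ix.
pose v : 'rV[R]_n.+1 := delta_mx 0 ord0.
have np := near_line v (@open_interior _ (closure A)) ix.
have nm := near_line (- v) (@open_interior _ (closure A)) ix.
have [e /= e0 He] := filterI np nm.
have [] := He (e / 2).
  by rewrite /= sub0r normrN gtr0_norm ?divr_gt0 // ltr_pdivrMr // ltr_pMr // ltr1n.
move=> /interior_subset c1 /interior_subset c2; apply: nx.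
have -> : x = (1 - 2^-1) *: (x + (e / 2) *: v) + 2^-1 *: (x + (e / 2) *: - v).
  by apply/rowP => i; rewrite !mxE; field.
apply: sA; [exact: c1 | exact: c2 | | by lra].
apply/eqP => /rowP /(_ ord0); rewrite /v !mxE !eqxx /= mulrN mulr1 => /eqP.
by rewrite -subr_eq0 => /eqP; lra.
Qed.

(** * The one-dimensional barrier *)

(** Integrating from [a - 1] rather than from [a] gives a two-sided derivative at
    [a]; the value at [a] is then subtracted. *)
Lemma antiderivative (R : realType) (q : R -> R) (a : R) : continuous q ->
  exists2 G : R -> R, G a = 0 & forall z, a - 1 < z -> is_derive z 1 G (q z).
Proof.
move=> cq.
pose F (x : R) := (\int[lebesgue_measure]_(t in [set` `[a - 1, x]]) q t)%R.
exists (fun x => F x - cst (F a) x) => [|z az]; first exact: subrr.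
have iq : lebesgue_measure.-integrable `[a - 1, z + 1] (EFin \o q).
  apply: continuous_compact_integrable; first exact: segment_compact.
  exact: continuous_subspaceT.
have zz : z < z + 1 by rewrite ltrDl.
have [dF Fq] := continuous_FTC1_closed zz iq az (cq z).
have dFq : is_derive z 1 F (q z) by split; [exact: dF | rewrite -derive1E].
by have := is_deriveB dFq (is_derive_cst (F a) z 1); rewrite subr0.
Qed.

(** When the cosine of the normal angle is [n], the slope is [sqrt (1 - n^2) / n]
    and [n / sqrt (1 - n^2)] is its inverse. *)
Lemma is_derive_slope_of_tilt (R : realType) (n : R -> R) (n1 z : R) :
  is_derive z 1 n n1 -> n z ^+ 2 < 1 ->
  is_derive z 1 (fun y => n y / Num.sqrt (1 - n y ^+ 2))
    (n1 / Num.sqrt (1 - n z ^+ 2) ^+ 3).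
Proof.
move=> dn nz.
pose S : R -> R := cst 1 - n * n.
have SE y : S y = 1 - n y ^+ 2 by rewrite /S expr2.
have S0 : 0 < S z by rewrite SE subr_gt0.
have dS : is_derive z 1 S (- (2 * n z * n1)).
  have := is_deriveB (is_derive_cst (1 : R) z 1) (is_deriveM dn dn).
  by move/is_derive_eq; apply; rewrite /GRing.scale/=; ring.
have dq : is_derive z 1 (Num.sqrt \o S) _ :=
  is_derive1_comp (is_derive1_sqrt S0) dS.
have q0 : Num.sqrt (S z) != 0 by rewrite sqrtr_eq0 -ltNge.
have sS : Num.sqrt (S z) ^+ 2 = 1 - n z ^+ 2 by rewrite sqr_sqrtr -?SE // ltW.
have dV : is_derive z 1 (fun y => (Num.sqrt (S y))^-1)
  (n z * n1 / Num.sqrt (S z) ^+ 3).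
  case: dq => dq eq; split; first exact: derivableV.
  rewrite deriveV // eq /GRing.scale/=; field.
  exact: q0.
have -> : (fun y => n y / Num.sqrt (1 - n y ^+ 2)) =
    (n * (fun y => (Num.sqrt (S y))^-1)).
  by apply/funext => y; rewrite -SE.
have := is_deriveM dn dV => /is_derive_eq; apply.
rewrite -SE /GRing.scale/=.
have -> : (Num.sqrt (S z))^-1 = Num.sqrt (S z) ^+ 2 / Num.sqrt (S z) ^+ 3.
  by field; exact: q0.
rewrite sS; field; exact: q0.
Qed.

Lemma tilt_of_slope (R : realType) (n : R) : 0 < n -> n < 1 ->
  tilt_of (n / Num.sqrt (1 - n ^+ 2))^-1 = n.
Proof.
move=> n0 n1; have n2 : 0 < 1 - n ^+ 2 by rewrite subr_gt0 expr_lt1 // ltW.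
apply/eqP; rewrite -(@eqrXn2 _ 2) ?(ltW n0) ?(ltW (tilt_of_gt0 _)) //.
rewrite tilt_of_sqr exprVn exprMn exprVn sqr_sqrtr ?(ltW n2) //; apply/eqP.
field; rewrite ?lt0r_neq0 //=.
by have -> : n ^+ 2 + (1 - n ^+ 2) = 1 by ring.
Qed.

(** [G] is the inverse function of a one-variable profile with heights in
    [[a, M]], [q] its derivative and [q1] the derivative of [q]; the profile has
    slope [1 / q z] at height [z].  Inverting avoids solving the profile's
    differential equation.  The last inequality says that the profile is a
    strict supersolution: along [G (u x) = dot e x] one has
    [mean_hess = - q1 / q^3]. *)
Definition strict_barrier (R : realType) (a M H : R) (G q q1 : R -> R) : Prop :=
  forall z, a <= z <= M -> [/\ 0 < q z,
    \forall y \near z, is_derive (y : R) 1 G (q y),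
    is_derive z 1 q (q1 z) &
    2 / z * (tilt_of (q z)^-1 - H) < tilt_of (q z)^-1 ^+ 3 * (q1 z / q z ^+ 3)].

(** The profile is prescribed by the cosine [n z] of its normal angle at height
    [z].  There [w^3 q1 / q^3] is the derivative of [n], so the condition of a
    strict supersolution reads [z n' > 2 (n - H)].  The exact solutions
    [n - H = c z^2] give equality, and subtracting a constant [d > 0] makes it
    strict.  With [c = (1 - H) / M^2] the value at height [M] is [1 - d], so
    [n < 1] on [[a, M]] and the slope does not vanish there. *)
Lemma strict_barrier_exists (R : realType) (a M H d : R) :
  0 < a -> a <= M -> H < 1 -> 0 < d ->
  let n z := H + (1 - H) / M ^+ 2 * z ^+ 2 - d in
  0 < n a ->
  exists G q q1 : R -> R, [/\ G a = 0, tilt_of (q a)^-1 = n a,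
    strict_barrier a M H G q q1 &
    forall z, a <= z <= M -> q a * (z - a) <= G z].
Proof.
move=> a0 aM H1 d0 n na0.
have M0 : 0 < M by exact: lt_le_trans aM.
pose c := (1 - H) / M ^+ 2.
have c0 : 0 < c by rewrite divr_gt0 ?subr_gt0 // exprn_gt0.
have cM : c * M ^+ 2 = 1 - H by rewrite divfK // lt0r_neq0 // exprn_gt0.
have nE z : n z = H + c * z ^+ 2 - d by [].
have n_incr y z : a <= y -> y <= z -> n y <= n z.
  move=> ay yz; rewrite !nE lerD2r lerD2l ler_pM2l // ler_pXn2r // nnegrE; lra.
have n_bd z : a <= z <= M -> 0 < n z /\ n z <= 1 - d.
  move=> /andP[az zM]; split; first exact: lt_le_trans (n_incr _ _ _ az).
  by have := n_incr _ _ az zM; rewrite [n M]nE cM; lra.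
have d1 : d < 1 by have [] := n_bd a; rewrite ?lexx ?aM //; lra.
(* The clamp at [k] makes [q] continuous on the whole line, so that it has an
   antiderivative; it is inactive for heights in [[a, M]]. *)
pose k := (1 - (1 - d) ^+ 2) / 2.
have k0 : 0 < k by rewrite /k; nra.
pose q z := n z / Num.sqrt (Num.max (1 - n z ^+ 2) k).
pose q1 z := 2 * c * z / Num.sqrt (1 - n z ^+ 2) ^+ 3.
have dn (z : R) : is_derive z 1 n (2 * c * z).
  have -> : n = cst (H - d) + c *: (@id R * @id R).
    by apply/funext => y; rewrite nE /= /GRing.scale/= !fctE /= /GRing.scale/=; ring.
  have := is_deriveD (is_derive_cst (H - d) z 1)
    (is_deriveZ c (is_deriveM (is_derive_id z 1) (is_derive_id z 1))).
  by move/is_derive_eq; apply; rewrite /GRing.scale/=; ring.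
have cn : continuous n.
  move=> z; apply: differentiable_continuous; apply/derivable1_diffP.
  by case: (dn z).
have cq : continuous q.
  move=> z; apply: continuousM; first exact: cn.
  apply: continuousV.
    by rewrite sqrtr_eq0 -ltNge lt_max k0 orbT.
  apply: continuous_comp; last exact: sqrt_continuous.
  apply: continuous_max; last exact: cst_continuous.
  apply: continuousB; first exact: cst_continuous.
  exact: (continuousM (cn z) (cn z)).
have n2k z : a <= z <= M -> k < 1 - n z ^+ 2.
  move=> /n_bd[nz nz1].
  have : n z ^+ 2 <= (1 - d) ^+ 2 by rewrite ler_pXn2r // nnegrE; lra.
  rewrite /k => ?; nra.
have qE z : k < 1 - n z ^+ 2 -> q z = n z / Num.sqrt (1 - n z ^+ 2).
  by move=> kz; rewrite /q max_l // ltW.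
have [G Ga dG] := antiderivative a cq.
have dGn z : a <= z <= M -> \forall y \near z, is_derive (y : R) 1 G (q y).
  move=> /andP[az zM]; near=> y; apply: dG.
  near: y; apply: lt_nbhsr; lra.
have q_ge z : a <= z <= M -> q a <= q z.
  move=> zaM; have aaM : a <= a <= M by rewrite lexx.
  have [nz _] := n_bd _ zaM.
  have kz := n2k _ zaM; have ka := n2k _ aaM; move/andP: zaM => [az zM].
  rewrite !qE //; have nn := n_incr _ _ (lexx a) az.
  have z0 : 0 < 1 - n z ^+ 2 by exact: lt_trans kz.
  have a1 : 0 < 1 - n a ^+ 2 by exact: lt_trans ka.
  apply: ler_pM => //; rewrite ?(ltW na0) ?invr_ge0 ?sqrtr_ge0 //.
  rewrite lef_pV2 ?posrE ?sqrtr_gt0 // ler_wsqrtr // lerD2l lerN2.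
  by rewrite ler_pXn2r // nnegrE ltW.
have G_ge z : a <= z <= M -> q a * (z - a) <= G z.
  move=> /andP[az zM].
  have [->|az'] := eqVneq z a; first by rewrite subrr mulr0 Ga.
  have {}az : a < z by rewrite lt_def az' az.
  have dGi s : s \in `]a, z[ -> is_derive s 1 G (q s).
    by move=> sz; apply: dG; rewrite (@lt_trans _ _ a) ?(itvP sz) // ltrBlDr ltrDl.
  have cG : {within `[a, z], continuous G}.
    apply: derivable_within_continuous => s sz.
    have /dG[] // : a - 1 < s by rewrite (@lt_le_trans _ _ a) ?(itvP sz) // ltrBlDr ltrDl.
  have [s sz] := MVT az dGi cG; rewrite Ga subr0 => ->.
  rewrite ler_pM2r ?subr_gt0 //; apply: q_ge.
  by rewrite !ltW ?(itvP sz) // (lt_le_trans _ zM) // (itvP sz).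
exists G, q, q1; split; [exact: Ga | | move=> z zaM | exact: G_ge].
  have aaM : a <= a <= M by rewrite lexx.
  by rewrite qE ?n2k // tilt_of_slope //; have [] := n_bd _ aaM; lra.
have [nz nz1] := n_bd _ zaM; have kz := n2k _ zaM.
have z1 : 0 < 1 - n z ^+ 2 by exact: lt_trans kz.
have s0 : 0 < Num.sqrt (1 - n z ^+ 2) by rewrite sqrtr_gt0.
have z0 : 0 < z by case/andP: zaM => az _; exact: lt_le_trans az.
split.
- by rewrite qE // divr_gt0.
- exact: dGn.
- apply: (@near_eq_is_derive _ _ _ (fun y => n y / Num.sqrt (1 - n y ^+ 2))).
    have ck : {for z, continuous (fun y => 1 - n y ^+ 2)}.
      apply: continuousB; first exact: cst_continuous.
      exact: (continuousM (cn z) (cn z)).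
    have kn : \forall y \near z, k < 1 - n y ^+ 2 := ck _ (lt_nbhsr kz).
    by apply: filterS kn => y ky; rewrite qE.
  by apply: is_derive_slope_of_tilt => //; lra.
- rewrite qE // tilt_of_slope //; last lra.
  rewrite /q1.
  have -> : n z ^+ 3 * (2 * c * z / Num.sqrt (1 - n z ^+ 2) ^+ 3 /
    (n z / Num.sqrt (1 - n z ^+ 2)) ^+ 3) = 2 / z * (c * z ^+ 2).
    by field; rewrite !lt0r_neq0.
  rewrite ltr_pM2l ?divr_gt0 // nE; lra.
Unshelve. all: by end_near. Qed.

(** * Comparison for solutions *)

(** Test the growth of [u] in the direction of its gradient. *)
Lemma gradient_bound (R : realType) (n : nat) (A : set 'rV[R]_n)
    (u : 'rV[R]_n -> R) (c : 'rV[R]_n) (K : R) :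
  open A -> smooth_on A u -> A c -> 0 <= K ->
  (forall y, A y -> u y <= u c + K * enorm (y - c)) ->
  enorm (gradient u c) <= K.
Proof.
move=> oA su Ac K0 uK; set p := gradient u c.
have [p0|p0] := eqVneq (enorm p) 0; first by rewrite p0.
have pp : 0 < enorm p by rewrite lt_def p0 enorm_ge0.
rewrite leNgt; apply/negP => Kp.
have [g [fg g0 _]] := jet2B (jet2_line p oA su Ac) (jet2_affine 0 (K * enorm p)).
have := nbhs_singleton fg; rewrite /= g0 => dg.
have [|e e0 He] := is_derive_gt0_near dg.
  by rewrite subr_gt0 -enorm_sqr expr2 ltr_pM2r.
have [e' /= e'0 He'] := near_line p oA Ac.
pose t := Num.min e e' / 2.
have t0 : 0 < t by rewrite divr_gt0 // lt_min e0 e'0.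
have [te te'] : t < e /\ t < e'.
  have : t < Num.min e e' by rewrite /t ltr_pdivrMr // ltr_pMr ?ltr1n // lt_min e0 e'0.
  by rewrite lt_min => /andP.
have Act : A (c + t *: p) by apply: He'; rewrite /= sub0r normrN gtr0_norm.
have := He t t0 te; rewrite scale0r addr0 mul0r addr0 subr0 add0r.
have := uK _ Act; rewrite [c + _ - c]addrC addKr enormZ ?(ltW t0) //.
by rewrite -/p; lra.
Qed.

Lemma solution_mean_hess (R : realType) (A : set 'rV[R]_2) (a H : R)
    (u : 'rV[R]_2 -> R) (x : 'rV[R]_2) :
  open A -> dirichlet_solution A a H u -> A x ->
  tilt u x ^+ 3 * mean_hess u x = - (2 / u x) * (tilt u x - H).
Proof.
move=> oA [su _ _ eqn _] Ax; rewrite -(divergence_mean_hess oA su Ax).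
exact: eqn.
Qed.

(** At an interior minimum the gradient vanishes, so the right-hand side of the
    equation is [-(2 / u) (1 - H) < 0] while [mean_hess >= 0]. *)
Lemma solution_ge (R : realType) (A : set 'rV[R]_2) (a H : R)
    (u : 'rV[R]_2 -> R) : H < 1 -> A !=set0 -> open A -> bounded_set A ->
  dirichlet_solution A a H u -> forall y, closure A y -> a <= u y.
Proof.
move=> H1 A0 oA bA sol; have [su cu u0 _ ua] := sol.
have cA0 : closure A !=set0 by case: A0 => x Ax; exists x; exact: subset_closure.
have [c] := EVT_min_rV cA0 (compact_closure_bounded bA) cu.
rewrite inE => cc cmin y cy.
have {}cmin z : closure A z -> u c <= u z by move=> cz; apply: cmin; rewrite inE.
have [Ac|bc] := closure_open_boundary oA cc; last by rewrite -(ua _ bc) cmin.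
exfalso.
have min_jet h : dot h (gradient u c) = 0 /\ 0 <= hessq u c h.
  have := jet2B (jet2_affine 0 0) (jet2_line h oA su Ac).
  move=> /jet2_max [|d0 h0]; last by split; lra.
  apply: filterS (near_line h oA Ac) => t At.
  rewrite !mulr0 !addr0 !sub0r scale0r addr0 lerN2; apply: cmin.
  exact: subset_closure.
have g0 : enorm (gradient u c) = 0.
  by apply/eqP; rewrite -sqrf_eq0 enorm_sqr; apply/eqP; case: (min_jet (gradient u c)).
have t1 : tilt u c = 1 by rewrite /tilt g0 /tilt_of expr0n addr0 sqrtr1 invr1.
have := solution_mean_hess oA sol Ac; rewrite t1 expr1n mul1r => N.
have : 0 <= mean_hess u c by rewrite !addr_ge0 //; exact: (min_jet _).2.
rewrite N mulNr oppr_ge0 leNgt mulr_gt0 ?divr_gt0 ?subr_gt0 //; exact: u0.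
Qed.

(** If [G (u y) - dot e y] has an interior maximum, the first-order conditions
    give [q (u) Du = e].  So the graph has there the slope of the barrier, and
    the second-order conditions along the axes and along [rot (gradient u)] add
    up to [mean_hess <= - q1 / q^3], against the strict inequality of the
    barrier.  The maximum is thus on the boundary, where [u = a] and [G = 0]. *)
Lemma halfplane_barrier (R : realType) (A : set 'rV[R]_2) (a M H k : R)
    (u : 'rV[R]_2 -> R) (e : 'rV[R]_2) (G q q1 : R -> R) :
  open A -> bounded_set A -> dirichlet_solution A a H u ->
  (forall y, closure A y -> a <= u y <= M) ->
  dot e e = 1 -> (forall y, closure A y -> k <= dot e y) ->
  G a = 0 -> strict_barrier a M H G q q1 ->
  forall y, closure A y -> G (u y) <= dot e y - k.
Proof.
move=> oA bA sol uM e1 ek Ga prof y cy; have [su cu u0 _ ua] := sol.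
have cA0 : closure A !=set0 by exists y.
have cG : {within closure A, continuous (fun y => G (u y) - dot e y)}.
  rewrite continuous_subspace_in => x; rewrite inE => cx.
  have [_ dG _ _] := prof _ (uM _ cx).
  have cGx : {for u x, continuous G}.
    apply: differentiable_continuous; apply/derivable1_diffP.
    by case: (nbhs_singleton dG).
  have ce : {within closure A, continuous (dot e)}.
    have -> : dot e = \sum_(i < 2) (fun v : 'rV[R]_2 => e 0 i *: v 0 i).
      by apply/funext => v; rewrite fct_sumE.
    apply: continuous_subspaceT => z; apply: differentiable_continuous.
    apply: differentiable_sum => i.
    by apply: differentiableZ; exact: differentiable_coord.
  by apply: cvgB; [exact: cvg_comp (cu x) cGx | exact: ce].
have [c] := EVT_max_rV cA0 (compact_closure_bounded bA) cG.
rewrite inE => cc cmax.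
have {}cmax z : closure A z -> G (u z) - dot e z <= G (u c) - dot e c.
  by move=> cz; apply: cmax; rewrite inE.
have [Ac|bc] := closure_open_boundary oA cc; last first.
  by have := cmax _ cy; rewrite (ua _ bc) Ga; have := ek _ cc; lra.
exfalso.
have [q0 dG dq strict] := prof _ (uM _ cc).
set z := u c in q0 dG dq strict.
have max_jet h : q z * dot h (gradient u c) = dot e h /\
    q1 z * dot h (gradient u c) ^+ 2 + q z * hessq u c h <= 0.
  have jl := jet2_line h oA su Ac.
  have uc : u (c + 0 *: h) = z by rewrite scale0r addr0.
  have := @jet2_comp _ G q _ _ _ (q1 z) jl; rewrite uc => /(_ dG dq) jc.
  have := jet2B jc (jet2_affine (dot e c) (dot e h)).
  move=> /jet2_max [|d0 h0]; last by split; [move: d0 | move: h0]; lra.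
  apply: filterS (near_line h oA Ac) => t At.
  have := cmax _ (subset_closure At).
  by rewrite /= scale0r mul0r !addr0 dotDr dotZr.
set p := gradient u c in max_jet.
have ep : e = q z *: p.
  apply/rowP => i; rewrite mxE; have [] := max_jet (delta_mx 0 i).
  by rewrite dot_delta dotC dot_delta.
(* The slope of [u] at [c] is that of the barrier, because [e] has length one. *)
have pq : enorm p = (q z)^-1.
  apply/eqP; rewrite -(@eqrXn2 _ 2) ?enorm_ge0 ?invr_ge0 ?(ltW q0) //.
  move: e1; rewrite ep dotZl dotZr -enorm_sqr => e1.
  apply/eqP; rewrite -[LHS]mul1r -[in RHS]div1r.
  have -> : enorm p ^+ 2 = (q z) ^- 2 * (q z * (q z * enorm p ^+ 2)).
    by field; rewrite lt0r_neq0.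
  by rewrite e1; field; rewrite lt0r_neq0.
have tq : tilt u c = tilt_of (q z)^-1 by rewrite /tilt -/p pq.
have := solution_mean_hess oA sol Ac; rewrite tq -/z.
set w := tilt_of (q z)^-1 in tq strict *; move=> N.
have w0 : 0 < w by exact: tilt_of_gt0.
have sum : q1 z * enorm p ^+ 2 + q z * mean_hess u c <= 0.
  rewrite enorm_sqr {1}/dot sum_ord2.
  have [_ ] := max_jet (delta_mx 0 ord0); rewrite dot_delta.
  have [_ ] := max_jet (delta_mx 0 ord_max); rewrite dot_delta.
  have [_ ] := max_jet (rot p); rewrite dot_rot expr0n mulr0 add0r.
  rewrite /mean_hess -/p; lra.
have {}sum : w ^+ 3 * (q1 z / q z ^+ 3) + w ^+ 3 * mean_hess u c <= 0.
  have -> : w ^+ 3 * (q1 z / q z ^+ 3) + w ^+ 3 * mean_hess u c =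
    w ^+ 3 / q z * (q1 z * enorm p ^+ 2 + q z * mean_hess u c).
    by rewrite pq; field; rewrite lt0r_neq0.
  by rewrite pmulr_rle0 // divr_gt0 // exprn_gt0.
by move: sum; rewrite N; lra.
Qed.

Lemma boundary_growth (R : realType) (A : set 'rV[R]_2) (a M H : R)
    (u : 'rV[R]_2 -> R) (G q q1 : R -> R) :
  A !=set0 -> open A -> bounded_set A -> strictly_convex A ->
  dirichlet_solution A a H u ->
  (forall y, closure A y -> a <= u y <= M) ->
  G a = 0 -> strict_barrier a M H G q q1 ->
  (forall z, a <= z <= M -> q a * (z - a) <= G z) ->
  forall x y, boundary A x -> closure A y -> u y <= a + (q a)^-1 * enorm (y - x).
Proof.
move=> A0 oA bA sA sol uM Ga prof lin x y bx cy.
have aM : a <= a <= M.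
  have [x0 Ax0] := A0; have /andP[ax xM] := uM _ (subset_closure Ax0).
  by rewrite lexx (le_trans ax).
have [qa0 _ _ _] := prof _ aM.
have out z : ~ closure A z -> u y <= a + (q a)^-1 * enorm (y - z).
  move=> nz; have [e [k [e1 ek ez]]] := separating_unit_vector A0 bA sA nz.
  have Gy := halfplane_barrier oA bA sol uM e1 ek Ga prof cy.
  have := lin _ (uM _ cy).
  have ee : enorm e = 1.
    apply/eqP; rewrite -(@eqrXn2 _ 2) ?enorm_ge0 //.
    by rewrite enorm_sqr e1 expr1n.
  have : dot e (y - z) <= enorm (y - z).
    by rewrite -[leRHS]mul1r -ee dot_enorm.
  rewrite dotBr => dyz lin_y.
  rewrite -lerBlDl ler_pdivlMl //; lra.
rewrite leNgt; apply/negP => ux.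
apply: (boundary_not_near_closure sA bx).
pose f z := a + (q a)^-1 * enorm (y - z).
have cf : {for x, continuous f}.
  apply: continuousD; first exact: cst_continuous.
  apply: continuousM; first exact: cst_continuous.
  apply: (@continuous_comp _ _ _ (fun z : 'rV[R]_2 => y - z) (@enorm R 2)).
    by apply: continuousB => w; [exact: cst_continuous | exact: id].
  exact: enorm_continuous.
have nf : \forall z \near x, f z < u y := cf _ (lt_nbhsl ux).
apply: filterS nf => z fz; apply: contrapT => /out; rewrite leNgt -/(f z) fz //.
Qed.

Lemma two_point_continuous (R : realType) (n : nat) (B : set 'rV[R]_n)
    (u : 'rV[R]_n -> R) (K : R) : {within B, continuous u} ->
  {within B `*` B, continuous
    (fun p : 'rV[R]_n * 'rV[R]_n => u p.2 - u p.1 - K * enorm (p.2 - p.1))}.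
Proof.
move=> /subspace_continuousP cu; apply/subspace_continuousP => -[x y] [/= Bx By].
apply: cvgB; last first.
  apply: cvg_within_filter; apply: cvgM; first exact: cvg_cst.
  apply: (@continuous_comp _ _ _ (fun p : 'rV[R]_n * 'rV[R]_n => p.2 - p.1) (@enorm R n)).
    by apply: cvgB; [exact: cvg_snd | exact: cvg_fst].
  exact: enorm_continuous.
apply: cvgB.
- apply: (cvg_comp _ _ _ (cu _ By)) => U /= BU.
  have : nbhs (x, y) (snd @^-1` (fun z => B z -> U z)) by apply: cvg_snd.
  by apply: filterS => -[p1 p2] /= BUp [Bp1 Bp2]; exact: BUp.
- apply: (cvg_comp _ _ _ (cu _ Bx)) => U /= BU.
  have : nbhs (x, y) (fst @^-1` (fun z => B z -> U z)) by apply: cvg_fst.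
  by apply: filterS => -[p1 p2] /= BUp [Bp1 Bp2]; exact: BUp.
Qed.

(** For [w > H] the right-hand side of the equation increases with the height:
    this monotonicity replaces a maximum principle. *)
Lemma height_le_of_mean_hess_le (R : realType) (w H m m' z z' : R) :
  0 < w -> H < w -> 0 < z -> 0 < z' ->
  w ^+ 3 * m = - (2 / z) * (w - H) -> w ^+ 3 * m' = - (2 / z') * (w - H) ->
  m <= m' -> z <= z'.
Proof.
move=> w0 Hw z0 z'0 E E' mm'.
have := ler_wpM2l (ltW (exprn_gt0 3 w0)) mm'; rewrite E E' !mulNr lerN2.
by rewrite ler_pM2r ?subr_gt0 // ler_pM2l // lef_pV2.
Qed.

Lemma solution_lipschitz (R : realType) (A : set 'rV[R]_2) (a H K : R)
    (u : 'rV[R]_2 -> R) :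
  open A -> bounded_set A -> dirichlet_solution A a H u ->
  (forall y, closure A y -> a <= u y) -> 0 <= K -> H < tilt_of K ->
  (forall x y, boundary A x -> closure A y -> u y <= a + K * enorm (y - x)) ->
  forall x y, closure A x -> closure A y -> u y <= u x + K * enorm (y - x).
Proof.
move=> oA bA sol ua K0 HK bd x' y' cx' cy'; have [su cu u0 _ uba] := sol.
have cK := compact_closure_bounded bA.
have KK0 : closure A `*` closure A !=set0 by exists (x', y').
have [[x y]] := compact_EVT_max KK0 (compact_setX cK cK) (@two_point_continuous _ _ _ _ K cu).
rewrite inE => -[/= cx cy] xymax.
have {}xymax z w : closure A z -> closure A w ->
    u w - u z - K * enorm (w - z) <= u y - u x - K * enorm (y - x).
  by move=> cz cw; apply: (xymax (z, w)); rewrite inE.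
have [le0|gt0] := leP (u y - u x - K * enorm (y - x)) 0.
  by have := xymax _ _ cx' cy'; lra.
exfalso.
have Kn : 0 <= K * enorm (y - x) by rewrite mulr_ge0 // enorm_ge0.
have uxy : u x < u y by move: gt0 Kn; lra.
have [Ay|by_] := closure_open_boundary oA cy; last first.
  by move: gt0; rewrite (uba _ by_); have := ua _ cx; lra.
have [Ax|bx] := closure_open_boundary oA cx; last first.
  by move: gt0; rewrite (uba _ bx); have := bd _ _ bx cy; lra.
have max_jet h : dot h (gradient u y) = dot h (gradient u x) /\
    hessq u y h <= hessq u x h.
  have := jet2B (jet2_line h oA su Ay) (jet2_line h oA su Ax).
  move=> /jet2_max [|/eqP]; last by rewrite subr_eq0 subr_le0 => /eqP.
  apply: filterS2 (near_line h oA Ax) (near_line h oA Ay) => t Axt Ayt.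
  have := xymax _ _ (subset_closure Axt) (subset_closure Ayt).
  (* Moving both points together leaves the penalty [K |y - x|] unchanged. *)
  have -> : y + t *: h - (x + t *: h) = y - x by rewrite opprD addrACA subrr addr0.
  by rewrite scale0r !addr0; lra.
have gE : gradient u y = gradient u x.
  by apply/rowP => i; have [] := max_jet (delta_mx 0 i); rewrite !dot_delta.
have gK : enorm (gradient u y) <= K.
  apply: (gradient_bound oA su Ay K0) => z Az.
  have := xymax _ _ cx (subset_closure Az).
  (* Moving [y] alone: the triangle inequality stands in for differentiating
     the distance. *)
  have : enorm (z - x) <= enorm (z - y) + enorm (y - x).
    by have := enormD (z - y) (y - x); rewrite addrA subrK.
  move=> /(ler_wpM2l K0); lra.
have w0 := tilt_of_gt0 (enorm (gradient u y)).
have wK := tilt_of_le (enorm_ge0 _) gK.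
have Ny := solution_mean_hess oA sol Ay.
have Nx := solution_mean_hess oA sol Ax.
have hess_le : mean_hess u y <= mean_hess u x.
  rewrite /mean_hess gE; do 2?apply: lerD; exact: (max_jet _).2.
have tE : tilt u x = tilt u y by rewrite /tilt gE.
rewrite tE in Nx; have wH : H < tilt u y := lt_le_trans HK wK.
have := height_le_of_mean_hess_le w0 wH (u0 _ Ay) (u0 _ Ax) Ny Nx hess_le.
by rewrite leNgt uxy.
Qed.

Lemma sup_solution (R : realType) (n : nat) (A : set 'rV[R]_n)
    (u : 'rV[R]_n -> R) : A !=set0 -> bounded_set A ->
  {within closure A, continuous u} ->
  forall x, A x -> u x <= sup [set u y | y in A].
Proof.
move=> [x0 Ax0] bA cu x Ax.
have cA0 : closure A !=set0 by exists x0; exact: subset_closure.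
have [c _ cmax] := EVT_max_rV cA0 (compact_closure_bounded bA) cu.
apply: sup_upper_bound; last by exists x.
split; first by exists (u x0), x0.
by exists (u c) => _ [y Ay <-]; apply: cmax; rewrite inE; exact: subset_closure.
Qed.

(** * The gradient estimate *)

Lemma tilt_lower_bound (R : realType) (A : set 'rV[R]_2) (a M H : R)
    (u : 'rV[R]_2 -> R) :
  A !=set0 -> open A -> bounded_set A -> strictly_convex A -> 0 < a -> H < 1 ->
  dirichlet_solution A a H u -> (forall x, A x -> u x <= M) ->
  0 < H + (1 - H) / M ^+ 2 * a ^+ 2 ->
  forall x, A x -> H + (1 - H) / M ^+ 2 * a ^+ 2 <= tilt u x.
Proof.
move=> A0 oA bA sA a0 H1 sol uM nu0 x Ax.
have ua := solution_ge H1 A0 oA bA sol.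
have [su cu u0 _ uba] := sol.
have aM : a <= M by apply: le_trans (uM _ Ax); exact/ua/subset_closure.
have uaM y : closure A y -> a <= u y <= M.
  move=> cy; rewrite ua //=.
  by have [/uM|/uba ->] := closure_open_boundary oA cy.
have M0 : 0 < M by exact: lt_le_trans aM.
pose b := (1 - H) / M ^+ 2 * a ^+ 2.
have b0 : 0 < b by rewrite mulr_gt0 ?divr_gt0 ?subr_gt0 ?exprn_gt0.
apply/ler_addgt0Pl => d d0.
(* [d'] is small enough for [H + b - d'] to stay positive and above [H]. *)
pose d' := Num.min d (Num.min ((H + b) / 2) (b / 2)).
have d'0 : 0 < d' by rewrite !lt_min d0 !divr_gt0.
have [d'd d'n d'b] : [/\ d' <= d, d' <= (H + b) / 2 & d' <= b / 2].
  by rewrite /d' !ge_min !lexx !orbT.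
have na0 : 0 < H + (1 - H) / M ^+ 2 * a ^+ 2 - d' by rewrite -/b; lra.
have [G [q [q1 [Ga nE prof lin]]]] := strict_barrier_exists a0 aM H1 d'0 na0.
have bd := boundary_growth A0 oA bA sA sol uaM Ga prof lin.
have aaM : a <= a <= M by rewrite lexx.
have [qa0 _ _ _] := prof _ aaM.
have K0 : 0 <= (q a)^-1 by rewrite invr_ge0 ltW.
have HK : H < tilt_of (q a)^-1 by rewrite nE -/b; lra.
have lip := solution_lipschitz oA bA sol ua K0 HK bd.
have gK : enorm (gradient u x) <= (q a)^-1.
  by apply: (gradient_bound oA su Ax K0) => y Ay; apply: lip; exact: subset_closure.
have := tilt_of_le (enorm_ge0 _) gK; rewrite nE -/(tilt u x) -/b; lra.
Qed.

(** Here [1 + H C = C n] with [n = H + 1 / C], and the right-hand side is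
    [sqrt (1 - n^2) / n], the slope whose cosine is [n]. *)
Lemma slope_le_of_tilt (R : realType) (C H s : R) :
  0 < C -> 0 < C^-1 + H -> 0 <= s -> H + C^-1 <= tilt_of s ->
  s <= Num.sqrt (C ^+ 2 - (1 + H * C) ^+ 2) / (1 + H * C).
Proof.
move=> C0 n0 s0 ns; set n := H + C^-1 in ns.
have n_gt0 : 0 < n by rewrite /n addrC.
have CE : 1 + H * C = C * n by rewrite /n; field; exact: lt0r_neq0.
have s21 : 0 < 1 + s ^+ 2 by rewrite ltr_pwDl // sqr_ge0.
have sn : n ^+ 2 * (1 + s ^+ 2) <= 1.
  rewrite -ler_pdivlMr // div1r -tilt_of_sqr ler_pXn2r // nnegrE ltW //.
  exact: tilt_of_gt0.
rewrite CE ler_pdivlMr ?mulr_gt0 //.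
rewrite -[leLHS]ger0_norm ?mulr_ge0 ?(ltW C0) ?(ltW n_gt0) // -sqrtr_sqr.
apply: ler_wsqrtr; rewrite !exprMn -subr_ge0.
have -> : C ^+ 2 - C ^+ 2 * n ^+ 2 - s ^+ 2 * (C ^+ 2 * n ^+ 2) =
  C ^+ 2 * (1 - n ^+ 2 * (1 + s ^+ 2)) by ring.
by rewrite mulr_ge0 ?sqr_ge0 // subr_ge0.
Qed.

Theorem theorem1p1 (R : realType) (Omega : set 'rV[R]_2) (a H : R)
    (u : 'rV[R]_2 -> R)
    (Omega_domain : domain Omega)
    (Omega_bounded : bounded_set Omega)
    (Omega_convex : strictly_convex Omega)
    (a_gt0 : 0 < a) (H_lt1 : H < 1)
    (u_sol : dirichlet_solution Omega a H u) :
  let uM : R := sup [set u x | x in Omega] in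
  let C : R := (1 - H)^-1 * (uM ^+ 2 / a ^+ 2) in
  0 <= H \/ (H < 0 /\ uM < Num.sqrt ((H - 1) / H) * a) ->
  forall x : 'rV[R]_2, Omega x ->
    enorm (gradient u x)
      <= Num.sqrt (C ^+ 2 - (1 + H * C) ^+ 2) / (1 + H * C).
Proof.
move=> M C HM x Ox.
have [nonempty oOmega _] := Omega_domain; have [_ cu u0 _ _] := u_sol.
have u_le_M := sup_solution nonempty Omega_bounded cu.
have M0 : 0 < M := lt_le_trans (u0 _ Ox) (u_le_M _ Ox).
have H1 : 0 < 1 - H by rewrite subr_gt0.
have Cinv : C^-1 = (1 - H) / M ^+ 2 * a ^+ 2.
  by rewrite /C; field; rewrite !lt0r_neq0.
have C0 : 0 < C by rewrite !mulr_gt0 ?invr_gt0 ?exprn_gt0.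
have nu0 : 0 < H + (1 - H) / M ^+ 2 * a ^+ 2.
  have b0 : 0 < (1 - H) / M ^+ 2 * a ^+ 2 by rewrite !mulr_gt0 ?invr_gt0 ?exprn_gt0.
  case: HM => [H0|[H0 MH]]; first by rewrite ltr_wpDl.
  have r0 : 0 <= (H - 1) / H by rewrite mulr_le0 // ?invr_le0; lra.
  have : M ^+ 2 < (Num.sqrt ((H - 1) / H) * a) ^+ 2.
    by rewrite ltr_pXn2r // nnegrE ?mulr_ge0 ?sqrtr_ge0 // ltW.
  rewrite exprMn sqr_sqrtr // => MH2.
  have {}MH2 : (H - 1) * a ^+ 2 < H * M ^+ 2.
    have -> : (H - 1) * a ^+ 2 = H * ((H - 1) / H * a ^+ 2) by field; exact: ltr0_neq0.
    by rewrite ltr_nM2l.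
  have -> : H + (1 - H) / M ^+ 2 * a ^+ 2 =
     (H * M ^+ 2 - (H - 1) * a ^+ 2) / M ^+ 2 by field; exact: lt0r_neq0.
  by rewrite divr_gt0 ?exprn_gt0 // subr_gt0.
apply: slope_le_of_tilt => //; first by rewrite Cinv addrC.
  exact: enorm_ge0.
rewrite Cinv.
exact: (tilt_lower_bound nonempty oOmega Omega_bounded Omega_convex a_gt0
  H_lt1 u_sol u_le_M nu0 Ox).
Qed.
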